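(* Let $X$, $d$, $r$, $\mathcal{L}$ and the refined data $\mathfrak{h}=(\mathcal{L},V_{X_1},V_{X_2},V_{X_3})$ be as described in the context. Then $\mathfrak{h}$ has at least one exact extension.
   Context: Curves are projective over an algebraically closed field $k$. $X$ is the union of three smooth connected curves $X_1,X_2,X_3$, where $X_1,X_2$ meet transversally at a single point $A$, $X_2,X_3$ meet transversally at a single point $B\neq A$, and $X_1\cap X_3=\emptyset$. For a union $Y$ of some components of $X$, $Y^c$ is the union of the other components. Fix integers $d,r\ge 0$ and an invertible sheaf $\mathcal{L}$ on $X$ of degree $d$ on $X_1$ and degree $0$ on $X_2$ and $X_3$. For integers $i,l\ge 0$ with $i+l\le d$, and $\underline{d}=(i,d-i-l,l)$, let $\mathcal{L}_{\underline{d}}=\mathcal{L}_{il}$ be the invertible sheaf on $X$ with restrictions $\mathcal{L}|_{X_1}(-(d-i)A)$, $\mathcal{L}|_{X_2}((d-i)A-lB)$, $\mathcal{L}|_{X_3}(lB)$; it has multidegree $\underline{d}$. Put $\mathcal{L}_{X_1}=\mathcal{L}_{(d,0,0)}$, $\mathcal{L}_{X_2}=\mathcal{L}_{(0,d,0)}$, $\mathcal{L}_{X_3}=\mathcal{L}_{(0,0,d)}$. Maps. For $\underline{d}=(i,d-i-l,l)\ge\underline 0$ and $q\in\{1,2,3\}$ let $\widetilde{\underline{d}}$ be $(i-1,d-i-l+1,l)$ if $q=1$, $(i+1,d-i-l-2,l+1)$ if $q=2$, $(i,d-i-l+1,l-1)$ if $q=3$. Whenever $\widetilde{\underline{d}}\ge\underline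 0$ there are natural maps $\varphi_{\underline{d},\widetilde{\underline{d}}}:\mathcal{L}_{\underline{d}}\to\mathcal{L}_{\underline{d}}|_{X_q^c}=\mathcal{L}_{\widetilde{\underline{d}}}|_{X_q^c}(-X_q\cap X_q^c)\hookrightarrow\mathcal{L}_{\widetilde{\underline{d}}}$ and $\varphi_{\widetilde{\underline{d}},\underline{d}}:\mathcal{L}_{\widetilde{\underline{d}}}\to\mathcal{L}_{\widetilde{\underline{d}}}|_{X_q}=\mathcal{L}_{\underline{d}}|_{X_q}(-X_q\cap X_q^c)\hookrightarrow\mathcal{L}_{\underline{d}}$ (restriction followed by inclusion, i.e. extension by zero); the same symbols denote the induced maps on global sections. For a subspace $V\subseteq H^0(X,\mathcal{L}_{\underline{d}})$ and a subcurve $Y$, $V^{Y,0}$ is the subspace of sections in $V$ vanishing on $Y$. Refined data $\mathfrak{h}$. $V_{X_q}\subseteq H^0(X,\mathcal{L}_{X_q})$ ($q=1,2,3$) are subspaces of dimension $r+1$ which are linked: the compositions of the maps $\varphi$ along the chains of multidegrees $(d,0,0),(d-1,1,0),\dots,(0,d,0)$ and $(0,d,0),(0,d-1,1),\dots,(0,0,d)$, in both directions, map $V_{X_1}$ into $V_{X_2}$, $V_{X_2}$ into $V_{X_1}$, $V_{X_2}$ into $V_{X_3}$ and $V_{X_3}$ into $V_{X_2}$. Restriction to $X_q$ is injective on $V_{X_q}$, and $V_{X_q}$ is also regarded as a linear series in $H^0(X_q,\mathcal{L}_{X_q}|_{X_q})$. Let $a_0<\dots<a_r$ be the orders of vanishing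 of $V_{X_1}$ at $A$, $b_0<\dots<b_r$ and $b'_0<\dots<b'_r$ those of $V_{X_2}$ at $A$ and at $B$, and $c_0<\dots<c_r$ those of $V_{X_3}$ at $B$. The associated Eisenbud–Harris limit linear series is assumed refined: $a_{r-j}+b_j=d$ and $b'_j+c_{r-j}=d$ for $0\le j\le r$. Limit linear series and extensions. A limit linear series on $X$ of degree $d$ and dimension $r$ with sheaf $\mathcal{L}$ is a collection of subspaces $V_{\underline{d}}\subseteq H^0(X,\mathcal{L}_{\underline{d}})$ of dimension $r+1$, one for each $\underline{d}=(i,d-i-l,l)\ge\underline 0$, such that $\varphi_{\underline{d},\widetilde{\underline{d}}}(V_{\underline{d}})\subseteq V_{\widetilde{\underline{d}}}$ and $\varphi_{\widetilde{\underline{d}},\underline{d}}(V_{\widetilde{\underline{d}}})\subseteq V_{\underline{d}}$ for all $\underline{d}$ and $q$ with $\widetilde{\underline{d}}\ge\underline 0$. It is exact if always $\varphi_{\underline{d},\widetilde{\underline{d}}}(V_{\underline{d}})=V_{\widetilde{\underline{d}}}^{X_q,0}$ and $\varphi_{\widetilde{\underline{d}},\underline{d}}(V_{\widetilde{\underline{d}}})=V_{\underline{d}}^{X_q^c,0}$. An extension of $\mathfrak{h}$ is a limit linear series with sheaf $\mathcal{L}$ such that $V_{(d,0,0)}=V_{X_1}$, $V_{(0,d,0)}=V_{X_2}$, $V_{(0,0,d)}=V_{X_3}$; an exact extension is an extension which is exact. *)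

(* Defs.v *)
From HB Require Import structures.
From mathcomp Require Import all_boot all_order all_algebra.
From mathcomp Require Import boolp classical_sets functions.
From mathcomp Require Import freeg.

Set Implicit Arguments.
Unset Strict Implicit.
Unset Printing Implicit Defensive.
Import Order.TTheory GRing.Theory Num.Theory.
Local Open Scope classical_set_scope.
Local Open Scope ring_scope.

(** * Smooth connected projective curves

    A smooth connected projective curve over the algebraically closed field k
    is given by its function field K (finitely generated of transcendence
    degree one over k); its closed points are the discrete valuations of K
    trivial on k (Hartshorne, Algebraic Geometry, I.6). *)

Definition function_field (k K : fieldType) (iota : {rmorphism k -> K}) : Prop :=
  exists x : K,
    (forall p : {poly k}, p != 0 -> (map_poly iota p).[x] != 0) /\
    exists (n : nat) (e : 'I_n -> K), forall y : K,
      exists (den : {poly k}) (num : 'I_n -> {poly k}),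
        den != 0 /\
        y * (map_poly iota den).[x]
          = \sum_(j < n) (map_poly iota (num j)).[x] * e j.

Record curve (k : closedFieldType) := Curve {
  ffield :> fieldType;
  cst : {rmorphism k -> ffield};
  ffieldP : function_field cst
}.

(* Normalised discrete valuations.  The value at 0 should be +oo; it is set to
   the dummy value 0 so that each valuation is counted once. *)
Record closed_point (k : closedFieldType) (C : curve k) := ClosedPoint {
  val_at : C -> int;
  val_at0 : val_at 0 = 0;
  val_atM : forall f g, f != 0 -> g != 0 -> val_at (f * g) = val_at f + val_at g;
  val_atD : forall f g, f != 0 -> g != 0 -> f + g != 0 ->
    Num.min (val_at f) (val_at g) <= val_at (f + g);
  val_at_cst : forall c : k, val_at (cst C c) = 0;
  val_at_surj : exists t, val_at t = 1
}.

HB.instance Definition _ (k : closedFieldType) (C : curve k) :=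
  gen_eqMixin (closed_point C).
HB.instance Definition _ (k : closedFieldType) (C : curve k) :=
  gen_choiceMixin (closed_point C).

Section Curve.
Context (k : closedFieldType) (C : curve k).
Implicit Types (P : closed_point C) (D : {freeg (closed_point C) / int}) (f e : C).

Definition divisor := {freeg (closed_point C) / int}.

Definition ord_ge P (n : int) f : Prop := f = 0 \/ n <= val_at P f.

(* H^0(C, O(D)).  Every invertible sheaf on C is of the form O(D), and
   O(D)(n P) = O(D + n P) as subsheaves of the constant sheaf K. *)
Definition RR D : set C := [set f | forall P, ord_ge P (- coeff P D) f].

(* order of vanishing at P of f <> 0, as a section of O(D) *)
Definition sec_ord P D f : int := val_at P f + coeff P D.

(* e generates the stalk O(D)_P *)
Definition local_gen P D e : Prop := e != 0 /\ sec_ord P D e = 0.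

(* f lies in O(D)_P and its value in the fibre O(D)_P / m_P O(D)_P is c times
   the value of e *)
Definition fibre_coord P D e f (c : k) : Prop :=
  ord_ge P (1 - coeff P D) (f - cst C c * e).

(* a_0 < ... < a_(n-1) are the orders of vanishing at P of the linear series V
   of sections of O(D) *)
Definition vanishing_orders P D (V : set C) n (a : 'I_n -> nat) : Prop :=
  (forall i j : 'I_n, (i < j)%N -> (a i < a j)%N) /\
  [set sec_ord P D f | f in V `&` [set f | f != 0]] = range (fun j => (a j)%:Z).

End Curve.

(** * The curve X *)

Inductive xcomp := X1 | X2 | X3.

Definition xcomp_eqb (p q : xcomp) : bool :=
  match p, q with X1, X1 | X2, X2 | X3, X3 => true | _, _ => false end.
Lemma xcomp_eqP : Equality.axiom xcomp_eqb.
Proof. by case=> [] []; constructor. Qed.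
HB.instance Definition _ := hasDecEq.Build xcomp xcomp_eqP.

(* X is obtained from X_1, X_2, X_3 by gluing A1 to A2 (the node A) and B2 to B3
   (the node B). *)
Record chain (k : closedFieldType) := Chain {
  component :> xcomp -> curve k;
  A1 : closed_point (component X1);
  A2 : closed_point (component X2);
  B2 : closed_point (component X2);
  B3 : closed_point (component X3);
  A_neq_B : A2 <> B2
}.

(* Invertible sheaves on X: an invertible sheaf on each component, and an
   isomorphism of the two fibres at each node, given as the one that identifies
   the values of two local generators. *)
Record line_bundle (k : closedFieldType) (X : chain k) := LineBundle {
  lb_div : forall q : xcomp, divisor (X q);
  genA1 : X X1;
  genA2 : X X2;
  genB2 : X X2;
  genB3 : X X3;
  genA1P : local_gen (A1 X) (lb_div X1) genA1;
  genA2P : local_gen (A2 X) (lb_div X2) genA2;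
  genB2P : local_gen (B2 X) (lb_div X2) genB2;
  genB3P : local_gen (B3 X) (lb_div X3) genB3
}.

Section Chain.
Context (k : closedFieldType) (X : chain k).
Implicit Types (L : line_bundle X) (q : xcomp) (Y : pred xcomp).

(* rational sections on each component; all sections considered are of this
   form *)
Definition rsec := forall q, X q.
Implicit Types (s : rsec) (V : set rsec).

(* pairs of germs at A (resp. B) whose values are identified by L *)
Definition glueA L (f : X X1) (g : X X2) : Prop :=
  exists c : k, fibre_coord (A1 X) (lb_div L X1) (genA1 L) f c /\
                fibre_coord (A2 X) (lb_div L X2) (genA2 L) g c.
Definition glueB L (f : X X2) (g : X X3) : Prop :=
  exists c : k, fibre_coord (B2 X) (lb_div L X2) (genB2 L) f c /\
                fibre_coord (B3 X) (lb_div L X3) (genB3 L) g c.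

(* H^0(X, L) *)
Definition H0 L : set rsec :=
  [set s | (forall q, RR (lb_div L q) (s q)) /\
           glueA L (s X1) (s X2) /\ glueB L (s X2) (s X3)].

Definition lincomb n (c : 'I_n -> k) (e : 'I_n -> rsec) : rsec :=
  fun q => \sum_(j < n) cst (X q) (c j) * e j q.

(* V is a k-subspace of dimension n *)
Definition subspace_of_dim n V : Prop :=
  exists e : 'I_n -> rsec,
    (forall c, (forall q, lincomb c e q = 0) -> forall j, c j = 0) /\
    V = range (fun c => lincomb c e).

Definition restriction q V : set (X q) := [set s q | s in V].

(* V^{Y,0} *)
Definition vanishing V Y : set rsec :=
  V `&` [set s | forall q, Y q -> s q = 0].

(* restriction to the subcurve Y followed by extension by zero *)
Definition restr_ext Y s : rsec := fun q => if Y q then s q else 0.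

(* The sheaves L_{il}, with multidegree (i, d - i - l, l), for i + l <= d. *)
Definition twist_div d (D : forall q, divisor (X q)) (i l : nat) :
    forall q, divisor (X q) := fun q =>
  match q with
  | X1 => D X1 - << A1 X >> *+ (d - i)
  | X2 => D X2 + << A2 X >> *+ (d - i) - << B2 X >> *+ l
  | X3 => D X3 + << B3 X >> *+ l
  end.

(* The restrictions of L_{il} determine its gluing isomorphisms only up to
   scalars.  The equalities L_{il} = L_{il'}(- B) on X_1 \cup X_2 (for l' = l - 1)
   and L_{il} = L_{i'l}(- A) on X_2 \cup X_3 (for i' = i - 1) through which the
   maps phi are defined say that the gluing at A does not depend on l and the
   gluing at B does not depend on i; the choice is otherwise arbitrary. *)
Record twists d L (Lil : nat -> nat -> line_bundle X) : Prop := Twists {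
  twists_div : forall i l, (i + l <= d)%N ->
    lb_div (Lil i l) = twist_div d (lb_div L) i l;
  twists_glueA : forall i l l', (i + l <= d)%N -> (i + l' <= d)%N ->
    glueA (Lil i l) = glueA (Lil i l');
  twists_glueB : forall i i' l, (i + l <= d)%N -> (i' + l <= d)%N ->
    glueB (Lil i l) = glueB (Lil i' l);
  twists_baseA : glueA (Lil d 0%N) = glueA L;
  twists_baseB : glueB (Lil d 0%N) = glueB L
}.

(* tilde d q i l i' l': the multidegrees of (i, l) and (i', l') are >= 0 and the
   second one is the tilde of the first one, with respect to q *)
Definition tilde (d : nat) q (i l i' l' : nat) : Prop :=
  (i + l <= d)%N /\ (i' + l' <= d)%N /\
  match q with
  | X1 => i = i'.+1 /\ l' = l
  | X2 => i' = i.+1 /\ l' = l.+1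
  | X3 => i' = i /\ l = l'.+1
  end.

(* If tilde d q i l i' l', then L_{il}|Y = L_{i'l'}|Y(- X_q \cap Y) for
   Y = X_q^c, and L_{i'l'}|X_q = L_{il}|X_q(- X_q \cap X_q^c), as subsheaves of
   the same constant sheaf, so the maps below are the maps phi. *)
Definition phi q : rsec -> rsec := restr_ext (predC1 q).   (* from i l to i' l' *)
Definition phi_up q : rsec -> rsec := restr_ext (pred1 q). (* from i' l' to i l *)

(* The chain (d,0,0), ..., (0,d,0) consists of d steps with q = 1, and the chain
   (0,0,d), ..., (0,d,0) of d steps with q = 3. *)
Definition linked (d : nat) (V1 V2 V3 : set rsec) : Prop :=
  iter d (phi X1) @` V1 `<=` V2 /\ iter d (phi_up X1) @` V2 `<=` V1 /\
  iter d (phi_up X3) @` V2 `<=` V3 /\ iter d (phi X3) @` V3 `<=` V2.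

(* The values of V at (i, l) with i + l > d are irrelevant. *)
Record limit_linear_series (d r : nat) (Lil : nat -> nat -> line_bundle X)
    (V : nat -> nat -> set rsec) : Prop := LimitLinearSeries {
  lls_H0 : forall i l, (i + l <= d)%N -> V i l `<=` H0 (Lil i l);
  lls_dim : forall i l, (i + l <= d)%N -> subspace_of_dim r.+1 (V i l);
  lls_phi : forall q i l i' l', tilde d q i l i' l' ->
    phi q @` V i l `<=` V i' l';
  lls_phi_up : forall q i l i' l', tilde d q i l i' l' ->
    phi_up q @` V i' l' `<=` V i l
}.

Definition exact_lls (d : nat) (V : nat -> nat -> set rsec) : Prop :=
  forall q i l i' l', tilde d q i l i' l' ->
    phi q @` V i l = vanishing (V i' l') (pred1 q) /\
    phi_up q @` V i' l' = vanishing (V i l) (predC1 q).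

End Chain.

Arguments restriction {k X} q V.

(* Main.v *)
Require Import Defs.
From mathcomp Require Import all_boot all_order all_algebra.
From mathcomp Require Import boolp classical_sets functions.
From mathcomp Require Import freeg zify ring.

Set Implicit Arguments.
Unset Strict Implicit.
Unset Printing Implicit Defensive.
Import Order.TTheory GRing.Theory Num.Theory.
Local Open Scope classical_set_scope.
Local Open Scope ring_scope.

Local Notation cst := Defs.cst.

(** Call the restriction of V_(X_q) to X_q the aspect W_q.  The refined data are
    a direct sum of r + 1 pieces, each spanned by one chain of sections: a triple
    (f_1, f_2, f_3) with f_q in W_q, whose order at A is d - b on X_1 and b - d on
    X_2, whose order at B is b' on X_2 and - b' on X_3 (orders taken with respect
    to L), and whose leading terms match at both nodes ([chains_exist]).  To find
    them, choose f_2 of given order at A with the largest possible order at B: the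
    orders at B are then pairwise distinct, so the f_2 form a basis of W_2 adapted
    to both nodes ([bi_adapted]).  Refinedness provides f_1 and f_3 of the opposite
    orders, and a rescaling makes the leading terms match, because the residue
    field at a point is k ([residue_field]); this is also what the choice of f_2
    relies on.

    A single chain extends by an explicit tropical rule.  Give X_1, X_2, X_3 the
    weights i - b, 0, l - b' at (i, l), and keep f_q on those components whose
    weight is maximal, 0 on the others.  The truncated triple is a section of
    L_il: a kept component next to a dropped one vanishes at the node, and two
    adjacent kept components have weights that are equal, which is where their
    leading terms were matched ([H0_truncate]).  A step in direction q
    lowers the weight of X_q by one relative to the other two, so X_q is kept after
    the step exactly when it was the only component kept before it; otherwise it
    is dropped and nothing else changes ([supp_tilde]).  This is exactness for one
    chain.  Since the f_q of the different chains are independent on every X_q, a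
    combination vanishes on X_q only if it involves no chain kept on X_q,
    and the sum of the chains is exact too ([truncated_span_exact]).

    The sum has the prescribed values at the three extreme multidegrees
    because there a section with components in the aspects is determined by its
    component on X_q ([aspect_determines]): two sections that agree on one
    component differ on the next one by a section that vanishes at the node, to an
    order larger than any in the vanishing sequence of that aspect. *)

(** * Valuations and the residue field of a closed point *)

Section Valuation.
Context (k : closedFieldType) (C : curve k) (P : closed_point C).
Implicit Types (f g y z : C) (c : k).

Lemma val_at1 : val_at P 1 = 0.
Proof. by rewrite -(rmorph1 (cst C)) val_at_cst. Qed.

Lemma val_atN f : val_at P (- f) = val_at P f.
Proof.
have [->|f0] := eqVneq f 0; first by rewrite oppr0.
rewrite -mulN1r val_atM ?oppr_eq0 ?oner_eq0 //.
by rewrite -(rmorph1 (cst C)) -rmorphN val_at_cst add0r.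
Qed.

Lemma val_atX f n : f != 0 -> val_at P (f ^+ n) = val_at P f *+ n.
Proof.
move=> f0; elim: n => [|n IHn]; first by rewrite val_at1.
by rewrite exprS val_atM ?expf_neq0 // IHn mulrS.
Qed.

Lemma val_atV f : f != 0 -> val_at P f^-1 = - val_at P f.
Proof.
move=> f0; apply/eqP; rewrite -addr_eq0 addrC -val_atM ?invr_eq0 //.
by rewrite divff // val_at1.
Qed.

Lemma val_atZ c f : c != 0 -> val_at P (cst C c * f) = val_at P f.
Proof.
move=> c0; have [->|f0] := eqVneq f 0; first by rewrite mulr0.
by rewrite val_atM ?fmorph_eq0 // val_at_cst add0r.
Qed.

Lemma ord_geD n f g : ord_ge P n f -> ord_ge P n g -> ord_ge P n (f + g).
Proof.
have [->|f0] := eqVneq f 0; first by rewrite add0r.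
have [->|g0] := eqVneq g 0; first by rewrite addr0.
case=> [/eqP|nf]; first by rewrite (negPf f0).
case=> [/eqP|ng]; first by rewrite (negPf g0).
have [->|fg0] := eqVneq (f + g) 0; first by left.
by right; apply: le_trans (val_atD P f0 g0 fg0); rewrite le_min nf.
Qed.

Lemma ord_geN n f : ord_ge P n f -> ord_ge P n (- f).
Proof. by case=> [->|nf]; [left; rewrite oppr0 | right; rewrite val_atN]. Qed.

Lemma ord_geB n f g : ord_ge P n f -> ord_ge P n g -> ord_ge P n (f - g).
Proof. by move=> nf /ord_geN; apply: ord_geD. Qed.

Lemma ord_geZ n c f : ord_ge P n f -> ord_ge P n (cst C c * f).
Proof.
case=> [->|nf]; first by left; rewrite mulr0.
have [->|c0] := eqVneq c 0; first by left; rewrite rmorph0 mul0r.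
by right; rewrite val_atZ.
Qed.

Lemma ord_ge_sum n (I : Type) (s : seq I) (F : I -> C) :
  (forall i, ord_ge P n (F i)) -> ord_ge P n (\sum_(i <- s) F i).
Proof.
move=> nF; elim/big_ind: _ => [|f g|i _]; [by left | exact: ord_geD | exact: nF].
Qed.

Lemma ord_ge_trans m n f : m <= n -> ord_ge P n f -> ord_ge P m f.
Proof. by move=> mn [->|nf]; [left | right; apply: le_trans nf]. Qed.

Lemma val_atD_lt f g : f != 0 -> g != 0 -> val_at P f < val_at P g ->
  f + g != 0 /\ val_at P (f + g) = val_at P f.
Proof.
move=> f0 g0 fg.
have fg0 : f + g != 0.
  by apply/eqP => /eqP; rewrite addr_eq0 => /eqP fE; rewrite fE val_atN ltxx in fg.
split=> //; apply/eqP; rewrite eq_le.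
have := val_atD P f0 g0 fg0; rewrite (min_idPl (ltW fg)) => ->; rewrite andbT.
have := @val_atD _ _ P (f + g) (- g) fg0.
rewrite oppr_eq0 addrK val_atN ge_min => /(_ g0 f0) /orP[//|].
by rewrite leNgt fg.
Qed.

Lemma val_atD_neq f g : f != 0 -> g != 0 -> val_at P f != val_at P g ->
  f + g != 0 /\ (val_at P (f + g) = val_at P f \/ val_at P (f + g) = val_at P g).
Proof.
move=> f0 g0; rewrite neq_lt => /orP[fg|gf].
  by have [? ?] := val_atD_lt f0 g0 fg; split; [|left].
by rewrite addrC; have [? ?] := val_atD_lt g0 f0 gf; split; [|right].
Qed.

(** The smaller of two distinct valuations survives in a sum of two functions; the
    claim about the valuation of the sum makes the induction work. *)
Lemma val_at_sum_neq (I : eqType) (s : seq I) (F : I -> C) :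
  uniq s -> s != [::] -> {in s, forall i, F i != 0} ->
  {in s &, injective (fun i => val_at P (F i))} ->
  \sum_(i <- s) F i != 0 /\
  exists2 i, i \in s & val_at P (\sum_(i <- s) F i) = val_at P (F i).
Proof.
elim: s => // i s IHs /= /andP[is_ us] _ F0 Finj; rewrite big_cons.
have Fi0 : F i != 0 by apply: F0; rewrite mem_head.
have [s0|s0] := eqVneq s [::].
  by rewrite s0 big_nil addr0; split=> //; exists i; rewrite ?mem_head.
have [||S0 [j js Sj]] := IHs us s0.
- by move=> j js; apply: F0; rewrite inE js orbT.
- by move=> j1 j2 j1s j2s; apply: Finj; rewrite inE ?j1s ?j2s orbT.
have ij : val_at P (F i) != val_at P (\sum_(i <- s) F i).
  rewrite Sj; apply/eqP => /Finj; rewrite mem_head inE js orbT => /(_ isT isT) ij.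
  by rewrite ij js in is_.
have [FS0 [FSi|FSj]] := val_atD_neq Fi0 S0 ij; split=> //.
  by exists i; rewrite ?mem_head.
by exists j; rewrite ?inE ?js ?orbT ?FSj.
Qed.

Lemma val_at_sum_eq0 (I : finType) (F : I -> C) :
  (forall i j, F i != 0 -> F j != 0 -> val_at P (F i) = val_at P (F j) -> i = j) ->
  \sum_i F i = 0 -> forall i, F i = 0.
Proof.
move=> Finj SF0 i; apply/eqP/negP => /negP Fi0.
have [] := @val_at_sum_neq I (enum [pred i | F i != 0]) F (enum_uniq _).
- by apply/eqP => e0; have := mem_enum [pred i | F i != 0] i; rewrite e0 !inE Fi0.
- by move=> j; rewrite mem_enum.
- by move=> j1 j2; rewrite !mem_enum /=; apply: Finj.
rewrite big_enum /= => + _; move: SF0; rewrite (bigID (fun j => F j != 0)) /=.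
by rewrite [X in _ + X]big1 ?addr0 => [->|j /negPn/eqP //]; rewrite eqxx.
Qed.

End Valuation.

(** The outer variable of q is evaluated at z and the inner one, in the coefficients,
    at y. *)
Definition eval2 (k : closedFieldType) (C : curve k) (q : {poly {poly k}}) (y z : C) : C :=
  (map_poly (map_poly (cst C)) q).[z%:P].[y].

Section ResidueField.
Context (k : closedFieldType) (C : curve k).
Implicit Types (y z : C) (q : {poly {poly k}}).

Lemma eval2E q y z :
  eval2 q y z = \sum_(m < size q) (map_poly (cst C) q`_m).[y] * z ^+ m.
Proof.
rewrite /eval2 (@horner_coef_wide _ (size q) _ z%:P); last exact: size_poly.
rewrite horner_sum; apply: eq_bigr => m _.
by rewrite hornerM coef_map /= -rmorphXn /= hornerC.
Qed.

Lemma eval2_swap q y z : eval2 (swapXY q) y z = eval2 q z y.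
Proof. by rewrite /eval2 -swapXY_map horner2_swapXY. Qed.

Lemma eval2_shift q y z c :
  eval2 (q \Po ('X + c%:P%:P)) y z = eval2 q y (z + cst C c).
Proof.
rewrite /eval2 map_comp_poly horner_comp rmorphD /= map_polyX !map_polyC /=.
by rewrite map_polyC /= hornerD hornerX hornerC rmorphD.
Qed.

(** The function field is spanned over k(x) by n elements, so 1, y, ..., y^n are
    linearly dependent over k[x].  Clearing denominators, their coordinates form
    a matrix over k[x] with n + 1 rows and n columns; a zero column makes it square
    and singular, and a left kernel vector is the dependence. *)
Lemma algebraic_over_coordinate : exists x : C,
  (forall p : {poly k}, p != 0 -> (map_poly (cst C) p).[x] != 0) /\
  forall y : C, exists2 q : {poly {poly k}}, q != 0 & eval2 q x y = 0.
Proof.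
have [x [xtr [n [e eP]]]] := ffieldP C; exists x; split=> // y.
have /choice[den /choice[num dnP]] : forall a : nat, exists den, exists num : 'I_n -> {poly k},
    den != 0 /\ y ^+ a * (map_poly (cst C) den).[x]
              = \sum_(j < n) (map_poly (cst C) (num j)).[x] * e j.
  by move=> a; apply: eP.
pose M : 'M[{poly k}]_n.+1 := \matrix_(a, j) oapp (num a) 0 (unlift ord0 j).
have /det0P[v v0 vM] : \det M == 0.
  rewrite -det_tr; apply/det0P; exists (delta_mx 0 ord0).
    by apply/eqP => /matrixP/(_ 0 ord0); rewrite !mxE !eqxx => /eqP; rewrite oner_eq0.
  by rewrite -rowE; apply/rowP => a; rewrite !mxE unlift_none.
have vnum j : \sum_(a < n.+1) v 0 a * num a j = 0.
  have /rowP/(_ (fintype.lift ord0 j)) := vM; rewrite !mxE => {2}<-.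
  by apply: eq_bigr => a _; rewrite !mxE liftK.
pose q : {poly {poly k}} := \poly_(a < n.+1) (v 0 (inord a) * den a).
have qE (a : 'I_n.+1) : q`_a = v 0 a * den a by rewrite coef_poly ltn_ord inord_val.
exists q.
  have [a va] : exists a, v 0 a != 0.
    by apply/existsP; apply: contraNT v0 => /existsPn v0; apply/eqP/rowP => a;
       rewrite mxE; apply/eqP/negPn/v0.
  apply/eqP => q0; have := qE a; rewrite q0 coef0 => /esym/eqP.
  by rewrite mulf_eq0 (negPf va) (negPf (dnP a).1).
rewrite /eval2 (@horner_coef_wide _ n.+1 _ y%:P); last first.
  by rewrite (leq_trans (size_poly _ _)) ?size_poly.
rewrite horner_sum.
transitivity (\sum_(a < n.+1) \sum_(j < n)
    (map_poly (cst C) (v 0 a * num a j)).[x] * e j).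
  apply: eq_bigr => a _; rewrite hornerM coef_map /= qE -rmorphXn /= hornerC.
  rewrite rmorphM hornerM /= -mulrA [_.[x] * y ^+ _]mulrC (dnP a).2 mulr_sumr.
  by apply: eq_bigr => j _; rewrite rmorphM hornerM mulrA.
rewrite exchange_big big1 //= => j _; rewrite -mulr_suml -horner_sum -rmorph_sum.
by rewrite vnum rmorph0 horner0 mul0r.
Qed.

Context (P : closed_point C).

(** The residue of y at P is defined and lies outside k. *)
Definition generic y := forall c : k, y != cst C c /\ val_at P (y - cst C c) = 0.

(** P is trivial on k(y): over the algebraically closed field k, p(y) is a constant
    times a product of factors y - c. *)
Lemma generic_horner y p : generic y -> p != 0 ->
  (map_poly (cst C) p).[y] != 0 /\ val_at P (map_poly (cst C) p).[y] = 0.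
Proof.
move=> ygen p0; have [rs ->] := closed_field_poly_normal p.
rewrite linearZ /= hornerZ mulf_eq0 fmorph_eq0 lead_coef_eq0 (negPf p0) /=.
rewrite val_atZ ?lead_coef_eq0 //; elim: rs => [|z rs [IH0 IHv]].
  by rewrite big_nil rmorph1 hornerC oner_eq0 val_at1.
have yz0 : y - cst C z != 0 by rewrite subr_eq0; case: (ygen z).
rewrite big_cons rmorphM hornerM /= rmorphB /= map_polyX map_polyC /= hornerXsubC.
by rewrite mulf_eq0 negb_or yz0 IH0 val_atM // IHv (ygen z).2.
Qed.

(** A valuation that is trivial on k(y) is trivial on everything algebraic over k(y):
    if z had nonzero valuation, then in a polynomial relation for z over k[y] the
    nonzero terms would have distinct valuations. *)
Lemma generic_algebraic y z q :
  generic y -> q != 0 -> eval2 q y z = 0 -> z != 0 -> val_at P z = 0.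
Proof.
move=> ygen q0 qyz z0; apply/eqP/negP => /negP vz.
rewrite eval2E in qyz.
have Fv (m : 'I_(size q)) : q`_m != 0 -> (map_poly (cst C) q`_m).[y] * z ^+ m != 0 /\
    val_at P ((map_poly (cst C) q`_m).[y] * z ^+ m) = val_at P z *+ m.
  move=> qm; have [q1 q2] := generic_horner ygen qm.
  by rewrite mulf_neq0 ?expf_neq0 // val_atM ?expf_neq0 // q2 add0r val_atX.
have Fn0 (m : 'I_(size q)) : (map_poly (cst C) q`_m).[y] * z ^+ m != 0 -> q`_m != 0.
  by apply: contraNneq => ->; rewrite rmorph0 horner0 mul0r.
have q0' : (0 < size q)%N by rewrite size_poly_gt0.
have lt : ((size q).-1 < size q)%N by rewrite prednK.
have [Fl0 _] := Fv (Ordinal lt) ltac:(by rewrite -lead_coefE lead_coef_eq0).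
move/eqP: Fl0; apply; apply: (val_at_sum_eq0 (P := P)) qyz _ => i j /Fn0/Fv[_ vi] /Fn0/Fv[_ vj].
by rewrite vi vj => /(mulrIn vz)/val_inj.
Qed.

(** Otherwise u is generic.  The coordinate x is algebraic over k(u), hence so is
    each x - c, hence x is generic; but then a uniformiser, being algebraic over
    k(x), would have valuation 0. *)
Lemma residue_field u : u != 0 -> val_at P u = 0 -> exists c : k, ord_ge P 1 (u - cst C c).
Proof.
move=> u0 vu; apply: contrapT => nu.
have ugen : generic u.
  move=> c; have uc : u != cst C c.
    by apply/eqP => uc; apply: nu; exists c; left; rewrite uc subrr.
  split=> //; have [->|c0] := eqVneq c 0; first by rewrite rmorph0 subr0.
  have : ord_ge P 0 (u - cst C c).
    by apply: ord_geB; right; rewrite ?vu ?val_at_cst.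
  case=> [/eqP|ge0]; first by rewrite subr_eq0 (negPf uc).
  apply/eqP; rewrite eq_le ge0 andbT leNgt; apply/negP => gt0.
  by apply: nu; exists c; right; move: gt0; rewrite -gtz0_ge1.
have [x [xtr dep]] := algebraic_over_coordinate.
have xgen : generic x.
  move=> c; have xc : x != cst C c.
    have := xtr ('X - c%:P) _; rewrite polyXsubC_eq0 rmorphB /= map_polyX map_polyC /=.
    by rewrite hornerXsubC subr_eq0; apply.
  split=> //; have [q q0 qxu] := dep u.
  (* read the relation for u over k[x] as one for x over k[u], then shift by c *)
  apply: (@generic_algebraic u _ (swapXY q \Po ('X + c%:P%:P))) => //.
  - rewrite comp_poly2_eq0 ?swapXY_eq0 //; exact: size_XaddC.
  - by rewrite eval2_shift subrK eval2_swap.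
  - by rewrite subr_eq0.
have [t vt] := val_at_surj P; have [q q0 qxt] := dep t.
have t0 : t != 0 by apply/eqP => t0; rewrite t0 val_at0 in vt.
by have := generic_algebraic xgen q0 qxt t0; rewrite vt.
Qed.

End ResidueField.
(** * Linear series on a curve *)

Section LinearSeries.
Context (k : closedFieldType) (C : curve k).
Implicit Types (P Q : closed_point C) (D : divisor C) (W : set C) (f g e : C).

Definition comb n (c : 'I_n -> k) (e : 'I_n -> C) : C := \sum_(j < n) cst C (c j) * e j.

Definition span n (e : 'I_n -> C) : set C := range (fun c => comb c e).

Definition linear_set W :=
  W 0 /\ forall c f g, W f -> W g -> W (cst C c * f + g).

Lemma linear_set_comb W n c (e : 'I_n -> C) :
  linear_set W -> (forall j, W (e j)) -> W (comb c e).
Proof.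
move=> [W0 Wl] We; rewrite /comb; elim: (index_enum _) => [|j s IHs].
  by rewrite big_nil.
by rewrite big_cons; apply: Wl.
Qed.

Lemma linear_setB W f g : linear_set W -> W f -> W g -> W (f - g).
Proof.
by move=> [_ Wl] Wf Wg; rewrite -mulN1r addrC -(rmorph1 (cst C)) -rmorphN; apply: Wl.
Qed.

Lemma comb_linear n a c c' (e : 'I_n -> C) :
  comb (fun j => a * c j + c' j) e = cst C a * comb c e + comb c' e.
Proof.
rewrite /comb mulr_sumr -big_split; apply: eq_bigr => j _ /=.
by rewrite rmorphD rmorphM mulrDl mulrA.
Qed.

Lemma span_linear n (e : 'I_n -> C) : linear_set (span e).
Proof.
split; first by exists (fun=> 0) => //; rewrite /comb big1 // => j _; rewrite rmorph0 mul0r.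
by move=> a _ _ [c _ <-] [c' _ <-]; exists (fun j => a * c j + c' j); rewrite ?comb_linear.
Qed.

Definition independent n (e : 'I_n -> C) := forall c, comb c e = 0 -> forall j, c j = 0.

Lemma comb_mulmx n (c : 'rV[k]_n) (A : 'M[k]_n) (e : 'I_n -> C) :
  comb ((c *m A) 0) e = comb (c 0) (fun j => comb (A j) e).
Proof.
rewrite /comb; under [RHS]eq_bigr => j _ do rewrite mulr_sumr.
rewrite exchange_big; apply: eq_bigr => i _ /=.
rewrite mxE rmorph_sum mulr_suml; apply: eq_bigr => j _.
by rewrite rmorphM mulrA.
Qed.

(** A family of n independent vectors in a space spanned by n vectors spans it: the
    matrix expressing g in terms of e is invertible. *)
Lemma independent_span n (e g : 'I_n -> C) :
  (forall j, span e (g j)) -> independent g ->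
  span e = span g.
Proof.
move=> ge gind; apply/seteqP; split; last first.
  by move=> _ [c _ <-]; apply: linear_set_comb => //; apply: span_linear.
have /choice[M ME] : forall j, exists c, comb c e = g j.
  by move=> j; have [c _ cE] := ge j; exists c.
pose A : 'M[k]_n := \matrix_(j, i) M j i.
have AE : (fun j => comb (A j) e) = g.
  apply: funext => j; rewrite -ME; apply: eq_bigr => i _; by rewrite mxE.
have Aunit : A \in unitmx.
  rewrite unitmxE unitfE; apply/det0P => -[v v0 vA]; move/eqP: v0; apply.
  apply/rowP => j; rewrite mxE; apply: gind; rewrite -AE -comb_mulmx vA.
  by rewrite /comb big1 // => i _; rewrite mxE rmorph0 mul0r.
move=> _ [c _ <-]; exists ((\row_j c j *m invmx A) 0) => //.
rewrite -AE -comb_mulmx mulmxKV //; apply: eq_bigr => j _; by rewrite mxE.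
Qed.

Lemma independent_val P n (g : 'I_n -> C) :
  (forall j, g j != 0) -> injective (fun j => val_at P (g j)) -> independent g.
Proof.
move=> g0 ginj c c0 j.
have /eqP : cst C (c j) * g j = 0.
  apply: (val_at_sum_eq0 (P := P)) c0 j => i1 i2.
  rewrite !mulf_eq0 !fmorph_eq0 !negb_or => /andP[c1 _] /andP[c2 _].
  by rewrite !val_atZ // => /ginj.
by rewrite mulf_eq0 fmorph_eq0 (negPf (g0 j)) orbF => /eqP.
Qed.

(** The residue field at P is k, so the leading coefficient of f can be cancelled by
    a constant multiple of g. *)
Lemma same_val_combine P f g : f != 0 -> g != 0 -> val_at P f = val_at P g ->
  exists2 c : k, c != 0 & ord_ge P (val_at P g + 1) (f - cst C c * g).
Proof.
move=> f0 g0 fg; have [||c cP] := @residue_field _ _ P (f / g).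
- by rewrite mulf_neq0 ?invr_eq0.
- by rewrite val_atM ?invr_eq0 // val_atV // fg subrr.
have fgE : f - cst C c * g = (f / g - cst C c) * g by rewrite mulrBl divfK.
exists c.
  apply/eqP => c0; move: cP; rewrite c0 rmorph0 subr0.
  case=> [/eqP|]; first by rewrite mulf_eq0 invr_eq0 (negPf f0) (negPf g0).
  by rewrite val_atM ?invr_eq0 // val_atV // fg subrr.
rewrite fgE; have [->|h0] := eqVneq (f / g - cst C c) 0; first by left; rewrite mul0r.
right; rewrite val_atM // addrC lerD2r.
by case: cP => // /eqP; rewrite (negPf h0).
Qed.

Lemma vanishing_orders_ex P D W n (a : 'I_n -> nat) (j : 'I_n) :
  vanishing_orders P D W a -> exists f, [/\ W f, f != 0 & sec_ord P D f = (a j)%:Z].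
Proof.
move=> [_ aE]; have : range (fun j => (a j)%:Z) (a j)%:Z by exists j.
by rewrite -aE => -[f [Wf f0] fj]; exists f.
Qed.

Lemma vanishing_orders_in P D W n (a : 'I_n -> nat) f :
  vanishing_orders P D W a -> W f -> f != 0 -> exists j, sec_ord P D f = (a j)%:Z.
Proof.
move=> [_ aE] Wf f0.
have : [set sec_ord P D f | f in W `&` [set f | f != 0]] (sec_ord P D f) by exists f.
by rewrite aE => -[j _ jE]; exists j.
Qed.

Lemma vanishing_orders_inj P D W n (a : 'I_n -> nat) :
  vanishing_orders P D W a -> injective a.
Proof.
move=> [amono _] i j aij; case: (ltngtP i j) => [||/val_inj //].
  by move=> /amono; rewrite aij ltnn.
by move=> /amono; rewrite aij ltnn.
Qed.

Lemma vanishing_orders_bound P D W n (a : 'I_n -> nat) (d : nat) f :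
  vanishing_orders P D W a -> (forall j, a j <= d)%N -> W f ->
  ord_ge P (d%:Z + 1 - coeff P D) f -> f = 0.
Proof.
move=> aP ad Wf [//|df]; apply/eqP/negP => /negP f0.
have [j] := vanishing_orders_in aP Wf f0; rewrite /sec_ord => fj.
have := ad j; lia.
Qed.

(** Take g_j of maximal order at Q among the elements of order b_j at P.  If g_i and
    g_j with b_i < b_j had the same order at Q, then subtracting a multiple of g_j
    from g_i would raise the order at Q without changing the one at P. *)
Lemma bi_adapted P Q D W n (b b' : 'I_n -> nat) : linear_set W ->
  vanishing_orders P D W b -> vanishing_orders Q D W b' ->
  exists (g : 'I_n -> C) (s : 'I_n -> 'I_n), injective s /\ forall j,
    [/\ W (g j), g j != 0, sec_ord P D (g j) = (b j)%:Z
      & sec_ord Q D (g j) = (b' (s j))%:Z].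
Proof.
move=> Wlin bP b'P.
have /choice[g gP] : forall j, exists g,
    [/\ W g, g != 0, sec_ord P D g = (b j)%:Z & forall h, W h -> h != 0 ->
        sec_ord P D h = (b j)%:Z -> sec_ord Q D h <= sec_ord Q D g].
  move=> j; pose A m := `[< exists g, [/\ W g, g != 0, sec_ord P D g = (b j)%:Z
                                        & sec_ord Q D g = m%:Z] >].
  have exA : exists m, A m.
    have [g [Wg g0 gj]] := vanishing_orders_ex j bP.
    have [j' gj'] := vanishing_orders_in b'P Wg g0.
    by exists (b' j'); apply/asboolP; exists g.
  have bdA m : A m -> (m <= \max_j b' j)%N.
    move=> /asboolP[g [Wg g0 _ gm]].
    have [j'] := vanishing_orders_in b'P Wg g0; rewrite gm => -[->].
    exact: leq_bigmax.
  case: (ex_maxnP exA bdA) => m /asboolP[g [Wg g0 gj gm]] mmax.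
  exists g; split=> // h Wh h0 hj.
  have [j' hj'] := vanishing_orders_in b'P Wh h0.
  rewrite hj' gm lez_nat; apply: mmax; apply/asboolP; exists h; split=> //.
have /choice[s sP] : forall j, exists j', sec_ord Q D (g j) = (b' j')%:Z.
  by move=> j; have [Wg g0 _ _] := gP j; apply: vanishing_orders_in b'P Wg g0.
exists g, s; split; last by move=> j; have [] := gP j.
have sinj (i j : 'I_n) : (i < j)%N -> s i <> s j.
  move=> ij sij.
  have [Wi i0 iP imax] := gP i; have [Wj j0 jP _] := gP j.
  have Qij : val_at Q (g i) = val_at Q (g j).
    by have := sP i; have := sP j; rewrite sij /sec_ord; lia.
  have [c c0 cP] := same_val_combine i0 j0 Qij.
  have bij := bP.1 _ _ ij.
  have [h0 hP] : g i - cst C c * g j != 0 /\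
      val_at P (g i - cst C c * g j) = val_at P (g i).
    apply: val_atD_lt => //; first by rewrite oppr_eq0 mulf_neq0 ?fmorph_eq0.
    by rewrite val_atN val_atZ //; move: iP jP; rewrite /sec_ord; lia.
  have Wh : W (g i - cst C c * g j).
    apply: linear_setB => //; rewrite -[_ * _]addr0; apply: Wlin.2 => //; exact: Wlin.1.
  have := imax _ Wh h0; rewrite /sec_ord hP -/(sec_ord P D (g i)) => /(_ iP).
  by case: cP => [/eqP|]; [rewrite (negPf h0) | lia].
move=> i j sij; case: (ltngtP i j) => [/sinj//||/val_inj//].
by move=> /sinj; rewrite sij.
Qed.

Lemma fibre_coord_comb P D e n (c x : 'I_n -> k) (f : 'I_n -> C) :
  (forall j, fibre_coord P D e (f j) (x j)) ->
  fibre_coord P D e (comb c f) (\sum_j c j * x j).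
Proof.
move=> fx; rewrite /fibre_coord /comb rmorph_sum mulr_suml -sumrB.
apply: ord_ge_sum => j; rewrite rmorphM -mulrA -mulrBr.
exact: (ord_geZ _ (fx j)).
Qed.

Lemma fibre_coord_inj P D e f c c' : local_gen P D e ->
  fibre_coord P D e f c -> fibre_coord P D e f c' -> c = c'.
Proof.
move=> [e0 eP] fc fc'; apply/eqP; rewrite -subr_eq0; apply/negP => /negP cc'.
have : ord_ge P (1 - coeff P D) (cst C (c - c') * e).
  suff -> : cst C (c - c') * e = (f - cst C c' * e) - (f - cst C c * e) by apply: ord_geB.
  by rewrite rmorphB; ring.
case=> [/eqP|]; first by rewrite mulf_eq0 fmorph_eq0 (negPf e0) (negPf cc').
by rewrite val_atZ //; move: eP; rewrite /sec_ord; lia.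
Qed.

Lemma fibre_coord_ex P D e f : local_gen P D e -> f != 0 -> sec_ord P D f = 0 ->
  exists2 c, c != 0 & fibre_coord P D e f c.
Proof.
move=> [e0 eP] f0 fP; have [|c c0 cP] := @same_val_combine P f e f0 e0.
  by move: eP fP; rewrite /sec_ord; lia.
exists c => //; apply: ord_ge_trans cP; move: eP; rewrite /sec_ord; lia.
Qed.

Lemma fibre_coord0 P D e f : ord_ge P (1 - coeff P D) f -> fibre_coord P D e f 0.
Proof. by rewrite /fibre_coord rmorph0 mul0r subr0. Qed.

Lemma fibre_coordZ P D e f a c :
  fibre_coord P D e f c -> fibre_coord P D e (cst C a * f) (a * c).
Proof. by move=> fc; rewrite /fibre_coord rmorphM -mulrA -mulrBr; apply: (ord_geZ _ fc). Qed.

Lemma RR_comb D n (c : 'I_n -> k) (f : 'I_n -> C) :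
  (forall j, RR D (f j)) -> RR D (comb c f).
Proof. by move=> fD P; apply: ord_ge_sum => j; apply: ord_geZ; apply: fD. Qed.

End LinearSeries.
(** * Exactness of sums of truncated chains *)

Section Support.

(** Differences of weights are orders of vanishing: as sections of L_il, the members
    f_1 and f_2 of a chain with orders given by (b, b') vanish at A to the orders
    i - b and b - i, and f_2 and f_3 vanish at B to the orders b' - l and l - b'. *)
Definition weight (b b' i l : nat) (q : xcomp) : int :=
  match q with X1 => i%:Z - b%:Z | X2 => 0 | X3 => l%:Z - b'%:Z end.

Definition supp (b b' i l : nat) : pred xcomp := fun q =>
  [&& weight b b' i l X1 <= weight b b' i l q, weight b b' i l X2 <= weight b b' i l q
    & weight b b' i l X3 <= weight b b' i l q].

Lemma supp_neq0 b b' i l : exists q, supp b b' i l q.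
Proof.
rewrite /supp /=.
have [il|li] := leP (i%:Z - b%:Z) (l%:Z - b'%:Z).
  by have [l0|l0] := leP 0 (l%:Z - b'%:Z); [exists X3 | exists X2] => /=; lia.
by have [i0|i0] := leP 0 (i%:Z - b%:Z); [exists X1 | exists X2] => /=; lia.
Qed.

(** Weights are integers, and up to a common shift the step lowers the one of X_q by
    one.  This removes X_q from the set of maximal components if it was there, except
    when X_q alone was maximal: then it remains maximal, possibly with others. *)
Lemma supp_tilde b b' d q i l i' l' : tilde d q i l i' l' -> forall p,
  if supp b b' i' l' q then supp b b' i l p = (p == q)
  else supp b b' i' l' p = supp b b' i l p && (p != q).
Proof.
move=> [_ [_]] ilq p.
case: ifPn; case: q ilq p => -[-> ->] [];
  rewrite /supp /= ?eqxx ?andbT ?andbF /eq_op /= ?andbT ?andbF; lia.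
Qed.

End Support.

Section Family.
Context (k : closedFieldType) (X : chain k) (n : nat).
Context (f : 'I_n -> rsec X) (b b' : 'I_n -> nat).
Hypothesis f_indep : forall q, independent (fun j => f j q).

Definition truncate i l (j : 'I_n) : rsec X := restr_ext (supp (b j) (b' j) i l) (f j).

Definition truncated_span i l : set (rsec X) :=
  range (fun c : 'I_n -> k => lincomb c (truncate i l)).

Lemma lincomb_truncate i l c q : lincomb c (truncate i l) q =
  comb (fun j => if supp (b j) (b' j) i l q then c j else 0) (fun j => f j q).
Proof.
apply: eq_bigr => j _; rewrite /truncate /restr_ext.
by case: ifP; rewrite ?rmorph0 ?mulr0 ?mul0r.
Qed.

Lemma lincomb_truncate_eq0 i l c q : lincomb c (truncate i l) q = 0 ->
  forall j, supp (b j) (b' j) i l q -> c j = 0.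
Proof. by rewrite lincomb_truncate => /f_indep + j qj => /(_ j); rewrite qj. Qed.

Lemma truncated_span_dim i l : subspace_of_dim n (truncated_span i l).
Proof.
exists (truncate i l); split=> // c c0 j.
have [q qj] := supp_neq0 (b j) (b' j) i l.
exact: lincomb_truncate_eq0 (c0 q) _ qj.
Qed.

(** The chains kept on X_q after the step were supported on X_q before it and are
    killed by phi; the others only lose their component on X_q. *)
Lemma phi_lincomb d q i l i' l' c : tilde d q i l i' l' ->
  phi q (lincomb c (truncate i l)) =
  lincomb (fun j => if supp (b j) (b' j) i' l' q then 0 else c j) (truncate i' l').
Proof.
move=> ilq; apply: functional_extensionality_dep => p.
rewrite /phi /restr_ext !lincomb_truncate /=.
have [pq|pq] := boolP (p == q) => /=.
  rewrite /comb big1 // => j _; rewrite (eqP pq).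
  by case: (supp _ _ _ _ _); rewrite rmorph0 mul0r.
congr comb; apply: funext => j.
have := supp_tilde (b j) (b' j) ilq p; case: ifP => _ ->; last by rewrite pq andbT.
by rewrite (negPf pq); case: ifP.
Qed.

Lemma phi_up_lincomb d q i l i' l' c : tilde d q i l i' l' ->
  phi_up q (lincomb c (truncate i' l')) =
  lincomb (fun j => if supp (b j) (b' j) i' l' q then c j else 0) (truncate i l).
Proof.
move=> ilq; apply: functional_extensionality_dep => p.
rewrite /phi_up /restr_ext !lincomb_truncate /=.
have [/eqP pq|pq] := boolP (p == q).
  rewrite pq; congr comb; apply: funext => j.
  have := supp_tilde (b j) (b' j) ilq q; case: ifP => [_ ->|_ _]; first by rewrite eqxx.
  by case: ifP.
rewrite /comb big1 // => j _.
have := supp_tilde (b j) (b' j) ilq p; case: ifP => [_ ->|_ _].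
  by rewrite (negPf pq) rmorph0 mul0r.
by case: (supp _ _ _ _ _); rewrite rmorph0 mul0r.
Qed.

(** If a combination vanishes on X_q, independence on X_q kills the coefficients of
    all chains kept there; the remaining combination is a visible image by
    [phi_lincomb] or [phi_up_lincomb], with the same coefficients. *)
Lemma truncated_span_exact d : exact_lls d truncated_span.
Proof.
move=> q i l i' l' ilq; split; apply/seteqP; split.
- move=> _ [_ [c _ <-] <-]; split.
    by rewrite (phi_lincomb _ ilq); eexists.
  by move=> p /= /eqP ->; rewrite /phi /restr_ext /= eqxx.
- move=> _ [[c _ <-] /(_ q (eqxx q)) c0].
  exists (lincomb c (truncate i l)); first by exists c.
  rewrite (phi_lincomb _ ilq); congr lincomb; apply: funext => j.
  by case: ifP => // qj; rewrite (lincomb_truncate_eq0 c0).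
- move=> _ [_ [c _ <-] <-]; split.
    by rewrite (phi_up_lincomb _ ilq); eexists.
  by move=> p /= pq; rewrite /phi_up /restr_ext /= (negPf pq).
move=> _ [[c _ <-] c0].
exists (lincomb c (truncate i' l')); first by exists c.
rewrite (phi_up_lincomb _ ilq); congr lincomb; apply: funext => j.
case: ifPn => // qj; have [p pj] := supp_neq0 (b j) (b' j) i' l'.
have := supp_tilde (b j) (b' j) ilq p; rewrite (negPf qj) pj => /esym/andP[pil pq].
by rewrite (lincomb_truncate_eq0 (c0 p pq) pil).
Qed.

End Family.
(** * Gluing on the chain of curves *)

Section Sheaves.
Context (k : closedFieldType) (X : chain k).
Implicit Types (L : line_bundle X) (D : forall q, divisor (X q)).

Lemma coeff_point (C : curve k) (P Q : closed_point C) : coeff P << Q >> = (Q == P)%:Z.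
Proof. by rewrite coeffU mul1r; case: (Q == P). Qed.

Lemma coeff_twist1 d D i l (P : closed_point (X X1)) :
  coeff P (twist_div d D i l X1) = coeff P (D X1) - (A1 X == P)%:Z *+ (d - i).
Proof. by rewrite raddfB raddfMn /= coeff_point. Qed.

Lemma coeff_twist2 d D i l (P : closed_point (X X2)) :
  coeff P (twist_div d D i l X2) =
  coeff P (D X2) + (A2 X == P)%:Z *+ (d - i) - (B2 X == P)%:Z *+ l.
Proof. by rewrite raddfB raddfD !raddfMn /= !coeff_point. Qed.

Lemma coeff_twist3 d D i l (P : closed_point (X X3)) :
  coeff P (twist_div d D i l X3) = coeff P (D X3) + (B3 X == P)%:Z *+ l.
Proof. by rewrite raddfD raddfMn /= coeff_point. Qed.

Lemma coeff_twistA1 d D i l : (i <= d)%N ->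
  coeff (A1 X) (twist_div d D i l X1) = coeff (A1 X) (D X1) - d%:Z + i%:Z.
Proof. by move=> id; rewrite coeff_twist1 eqxx; lia. Qed.

Lemma A2_neq_B2 : (A2 X == B2 X) = false.
Proof. by apply/eqP/A_neq_B. Qed.

Lemma coeff_twistA2 d D i l : (i <= d)%N ->
  coeff (A2 X) (twist_div d D i l X2) = coeff (A2 X) (D X2) + d%:Z - i%:Z.
Proof. by move=> id; rewrite coeff_twist2 eqxx eq_sym A2_neq_B2; lia. Qed.

Lemma coeff_twistB2 d D i l :
  coeff (B2 X) (twist_div d D i l X2) = coeff (B2 X) (D X2) - l%:Z.
Proof. by rewrite coeff_twist2 eqxx A2_neq_B2; lia. Qed.

Lemma coeff_twistB3 d D i l :
  coeff (B3 X) (twist_div d D i l X3) = coeff (B3 X) (D X3) + l%:Z.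
Proof. by rewrite coeff_twist3 eqxx; lia. Qed.

Lemma H0_lincomb L n (c : 'I_n -> k) (v : 'I_n -> rsec X) :
  (forall j, H0 L (v j)) -> H0 L (lincomb c v).
Proof.
move=> vL; split; first by move=> q; apply: RR_comb => j; have [] := vL j.
split.
  have /choice[x xP] : forall j, glueA L (v j X1) (v j X2) by move=> j; have [_ []] := vL j.
  exists (\sum_j c j * x j); split; apply: fibre_coord_comb => j; by case: (xP j).
have /choice[x xP] : forall j, glueB L (v j X2) (v j X3) by move=> j; have [_ []] := vL j.
by exists (\sum_j c j * x j); split; apply: fibre_coord_comb => j; case: (xP j).
Qed.

Lemma fibre_coordB (C : curve k) (P : closed_point C) (D : divisor C) e f g c :
  fibre_coord P D e f c -> fibre_coord P D e g c -> ord_ge P (1 - coeff P D) (f - g).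
Proof.
move=> fc gc.
suff -> : f - g = (f - cst C c * e) - (g - cst C c * e) by apply: ord_geB.
by ring.
Qed.

Lemma glueA_det2 L f g g' : glueA L f g -> glueA L f g' ->
  ord_ge (A2 X) (1 - coeff (A2 X) (lb_div L X2)) (g - g').
Proof.
move=> [c [fc gc]] [c' [fc' gc']]; apply: fibre_coordB gc _.
by rewrite (fibre_coord_inj (genA1P L) fc fc').
Qed.

Lemma glueA_det1 L f f' g : glueA L f g -> glueA L f' g ->
  ord_ge (A1 X) (1 - coeff (A1 X) (lb_div L X1)) (f - f').
Proof.
move=> [c [fc gc]] [c' [fc' gc']]; apply: fibre_coordB fc _.
by rewrite (fibre_coord_inj (genA2P L) gc gc').
Qed.

Lemma glueB_det3 L f g g' : glueB L f g -> glueB L f g' ->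
  ord_ge (B3 X) (1 - coeff (B3 X) (lb_div L X3)) (g - g').
Proof.
move=> [c [fc gc]] [c' [fc' gc']]; apply: fibre_coordB gc _.
by rewrite (fibre_coord_inj (genB2P L) fc fc').
Qed.

Lemma glueB_det2 L f f' g : glueB L f g -> glueB L f' g ->
  ord_ge (B2 X) (1 - coeff (B2 X) (lb_div L X2)) (f - f').
Proof.
move=> [c [fc gc]] [c' [fc' gc']]; apply: fibre_coordB fc _.
by rewrite (fibre_coord_inj (genB3P L) gc gc').
Qed.

(** Sections that generate the fibres at the node have nonzero values there, so one of
    them can be rescaled to make the values correspond. *)
Lemma glueA_scale L f g : f != 0 -> g != 0 ->
  sec_ord (A1 X) (lb_div L X1) f = 0 -> sec_ord (A2 X) (lb_div L X2) g = 0 ->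
  exists2 a, a != 0 & glueA L (cst (X X1) a * f) g.
Proof.
move=> f0 g0 /(fibre_coord_ex (genA1P L) f0)[c c0 fc].
move=> /(fibre_coord_ex (genA2P L) g0)[c' c'0 gc].
exists (c' / c); first by rewrite mulf_neq0 ?invr_eq0.
by exists (c' / c * c); split; [apply: fibre_coordZ | rewrite divfK].
Qed.

Lemma glueB_scale L f g : f != 0 -> g != 0 ->
  sec_ord (B2 X) (lb_div L X2) f = 0 -> sec_ord (B3 X) (lb_div L X3) g = 0 ->
  exists2 a, a != 0 & glueB L f (cst (X X3) a * g).
Proof.
move=> f0 g0 /(fibre_coord_ex (genB2P L) f0)[c c0 fc].
move=> /(fibre_coord_ex (genB3P L) g0)[c' c'0 gc].
exists (c / c'); first by rewrite mulf_neq0 ?invr_eq0.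
by exists (c / c' * c'); split; [rewrite divfK | apply: fibre_coordZ].
Qed.

Lemma glueA_ord L f g : ord_ge (A1 X) (1 - coeff (A1 X) (lb_div L X1)) f ->
  ord_ge (A2 X) (1 - coeff (A2 X) (lb_div L X2)) g -> glueA L f g.
Proof. by move=> f1 g1; exists 0; split; apply: fibre_coord0. Qed.

Lemma glueB_ord L f g : ord_ge (B2 X) (1 - coeff (B2 X) (lb_div L X2)) f ->
  ord_ge (B3 X) (1 - coeff (B3 X) (lb_div L X3)) g -> glueB L f g.
Proof. by move=> f1 g1; exists 0; split; apply: fibre_coord0. Qed.

Context (d : nat) (L : line_bundle X) (Lil : nat -> nat -> line_bundle X).
Hypothesis LilP : twists d L Lil.
Local Notation D := (lb_div L).

(** Orders are measured with respect to L at every node, so that the condition does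
    not depend on (i, l).  The values are matched at the only i, and the only l,
    for which f_1 and f_2, or f_2 and f_3, both generate the fibre of L_il. *)
Record chain_of_sections (b b' : nat) (s : rsec X) : Prop := ChainOfSections {
  cos_b : (b <= d)%N;
  cos_b' : (b' <= d)%N;
  cos1 : RR (lb_div (Lil d 0%N) X1) (s X1);
  cos2 : RR (lb_div (Lil 0%N 0%N) X2) (s X2);
  cos3 : RR (lb_div (Lil 0%N d) X3) (s X3);
  cosA1 : sec_ord (A1 X) (D X1) (s X1) = d%:Z - b%:Z;
  cosA2 : sec_ord (A2 X) (D X2) (s X2) = b%:Z - d%:Z;
  cosB2 : sec_ord (B2 X) (D X2) (s X2) = b'%:Z;
  cosB3 : sec_ord (B3 X) (D X3) (s X3) = - b'%:Z;
  cos_glueA : glueA (Lil b 0%N) (s X1) (s X2);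
  cos_glueB : glueB (Lil 0%N b') (s X2) (s X3)
}.

(** At a node between two kept components the weights agree, hence i = b (or l = b')
    and the gluing is part of the chain; between a kept and a dropped component the
    kept one has the strictly larger weight, hence vanishes at the node. *)
Lemma H0_truncate b b' s i l : (i + l <= d)%N -> chain_of_sections b b' s ->
  H0 (Lil i l) (restr_ext (supp b b' i l) s).
Proof.
move=> il [bd b'd s1 s2 s3]; rewrite /sec_ord => oA1 oA2 oB2 oB3 gA gB.
have id : (i <= d)%N by lia.
have DE := twists_div LilP il.
rewrite (twists_div LilP) ?addn0 // in s1.
rewrite (twists_div LilP) // in s2.
rewrite (twists_div LilP) // in s3.
split; [case|split] => [||| |].
- rewrite DE /restr_ext; case: ifP => [sX P|_ P]; last by left.
  rewrite /supp /= in sX.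
  have [PA|PA] := eqVneq (A1 X) P.
    by right; rewrite -PA coeff_twistA1 //; lia.
  have := s1 P; rewrite !coeff_twist1 (negPf PA) => -[|?]; [by left | right; lia].
- rewrite DE /restr_ext; case: ifP => [sX P|_ P]; last by left.
  rewrite /supp /= in sX.
  have [PA|PA] := eqVneq (A2 X) P.
    by right; rewrite -PA coeff_twistA2 //; lia.
  have [PB|PB] := eqVneq (B2 X) P.
    by right; rewrite -PB coeff_twistB2 //; lia.
  have := s2 P; rewrite !coeff_twist2 (negPf PA) (negPf PB) => -[|?]; [by left | right; lia].
- rewrite DE /restr_ext; case: ifP => [sX P|_ P]; last by left.
  rewrite /supp /= in sX.
  have [PB|PB] := eqVneq (B3 X) P.
    by right; rewrite -PB coeff_twistB3 //; lia.
  have := s3 P; rewrite !coeff_twist3 (negPf PB) => -[|?]; [by left | right; lia].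
- rewrite /restr_ext; case: ifPn => n1; case: ifPn => n2.
  + have ib : i = b by move: n1 n2; rewrite /supp /=; lia.
    rewrite ib (twists_glueA LilP (l' := 0%N)) // -?ib //; lia.
  + apply: glueA_ord; [right | by left].
    by rewrite DE coeff_twistA1 //; move: n1 n2; rewrite /supp /=; lia.
  + apply: glueA_ord; [by left | right].
    by rewrite DE coeff_twistA2 //; move: n1 n2; rewrite /supp /=; lia.
  + by apply: glueA_ord; left.
rewrite /restr_ext; case: ifPn => n2; case: ifPn => n3.
+ have lb : l = b' by move: n2 n3; rewrite /supp /=; lia.
  rewrite lb (twists_glueB LilP (i' := 0%N)) // -?lb //; lia.
+ apply: glueB_ord; [right | by left].
  by rewrite DE coeff_twistB2 //; move: n2 n3; rewrite /supp /=; lia.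
+ apply: glueB_ord; [by left | right].
  by rewrite DE coeff_twistB3 //; move: n2 n3; rewrite /supp /=; lia.
+ by apply: glueB_ord; left.
Qed.

End Sheaves.
(** * Decomposition of the refined data into chains *)

Section Extension.
Context (k : closedFieldType) (X : chain k) (d r : nat).
Context (L : line_bundle X) (Lil : nat -> nat -> line_bundle X).
Context (Vq : xcomp -> set (rsec X)) (a b b' c : 'I_r.+1 -> nat).
Local Notation D := (lb_div L).
Local Notation W q := (restriction q (Vq q)).
(* the sheaf of multidegree d on X_q and 0 elsewhere *)
Local Notation E q := (match q with
  | X1 => Lil d 0%N | X2 => Lil 0%N 0%N | X3 => Lil 0%N d end).
Hypothesis LilP : twists d L Lil.
Hypothesis Vq_H0 : forall q, Vq q `<=` H0 (E q).
Hypothesis Vq_dim : forall q, subspace_of_dim r.+1 (Vq q).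
Hypothesis Vq_linked : linked d (Vq X1) (Vq X2) (Vq X3).
Hypothesis aP : vanishing_orders (A1 X) (lb_div (Lil d 0%N) X1) (W X1) a.
Hypothesis bP : vanishing_orders (A2 X) (lb_div (Lil 0%N 0%N) X2) (W X2) b.
Hypothesis b'P : vanishing_orders (B2 X) (lb_div (Lil 0%N 0%N) X2) (W X2) b'.
Hypothesis cP : vanishing_orders (B3 X) (lb_div (Lil 0%N d) X3) (W X3) c.
Hypothesis refinedA : forall j : 'I_r.+1, (a (rev_ord j) + b j = d)%N.
Hypothesis refinedB : forall j : 'I_r.+1, (b' j + c (rev_ord j) = d)%N.

Lemma aspect_span q : exists e : 'I_r.+1 -> X q, W q = span e.
Proof.
have [e [_ ->]] := Vq_dim q; exists (fun j => e j q); apply/seteqP; split.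
  by move=> _ [_ [x _ <-] <-]; exists x.
by move=> _ [x _ <-]; exists (lincomb x e); first by exists x.
Qed.

Lemma aspect_linear q : linear_set (W q).
Proof. by have [e ->] := aspect_span q; apply: span_linear. Qed.

Lemma aspect_adapted q P (g : 'I_r.+1 -> X q) : (forall j, W q (g j)) ->
  (forall j, g j != 0) -> injective (fun j => val_at P (g j)) ->
  independent g /\ W q = span g.
Proof.
move=> gW g0 ginj; have gi := independent_val g0 ginj; split=> //.
by have [e We] := aspect_span q; rewrite We; apply: independent_span => // j; rewrite -We.
Qed.

Lemma aspect_RR q f : W q f -> RR (lb_div (E q) q) f.
Proof. by case=> s /Vq_H0[+ _] <-; apply. Qed.

Lemma iter_phi q p s : p != q -> iter d (@phi k X q) s p = s p.
Proof. by move=> pq; elim: d => //= m IHm; rewrite /phi /restr_ext /= pq. Qed.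

Lemma iter_phi_up q s : iter d (@phi_up k X q) s q = s q.
Proof. by elim: d => //= m IHm; rewrite /phi_up /restr_ext /= eqxx. Qed.

(** The maps phi that kill X_q leave the other components unchanged, and those that
    restrict to X_q leave that component unchanged.  Linkedness thus transports each
    component of a section to the aspect where it belongs. *)
Lemma aspect_comp p q s : Vq p s -> W q (s q).
Proof.
have [V12 [V21 [V23 V32]]] := Vq_linked.
have to1 s' : Vq X2 s' -> W X1 (s' X1).
  by move=> s'V; exists (iter d (@phi_up k X X1) s'); [apply: V21; exists s' | rewrite iter_phi_up].
have to3 s' : Vq X2 s' -> W X3 (s' X3).
  by move=> s'V; exists (iter d (@phi_up k X X3) s'); [apply: V23; exists s' | rewrite iter_phi_up].
have in1 s' : Vq X1 s' -> Vq X2 (iter d (@phi k X X1) s') by move=> ?; apply: V12; exists s'.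
have in3 s' : Vq X3 s' -> Vq X2 (iter d (@phi k X X3) s') by move=> ?; apply: V32; exists s'.
case: p => sV; case: q; try by [exists s | apply: to1 | apply: to3].
- by rewrite -(iter_phi (q := X1) s) //; exists (iter d (@phi k X X1) s) => //; apply: in1.
- by rewrite -(iter_phi (q := X1) s) //; apply/to3/in1.
- by rewrite -(iter_phi (q := X3) s) //; apply/to1/in3.
- by rewrite -(iter_phi (q := X3) s) //; exists (iter d (@phi k X X3) s) => //; apply: in3.
Qed.

Lemma chains_exist : exists (f : 'I_r.+1 -> rsec X) (s : 'I_r.+1 -> 'I_r.+1),
  (forall j, chain_of_sections d L Lil (b j) (b' (s j)) (f j)) /\
  forall q, independent (fun j => f j q) /\ W q = span (fun j => f j q).
Proof.
have [g2 [s [sinj g2P]]] := bi_adapted (aspect_linear X2) bP b'P.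
have /choice[g1 g1P] j := vanishing_orders_ex (rev_ord j) aP.
have /choice[g3 g3P] j := vanishing_orders_ex (rev_ord (s j)) cP.
have db j : (b j <= d)%N by have := refinedA j; lia.
have db' j : (b' j <= d)%N by have := refinedB j; lia.
have oA1 j : sec_ord (A1 X) (D X1) (g1 j) = d%:Z - (b j)%:Z.
  have [_ _] := g1P j; rewrite /sec_ord (twists_div LilP) ?addn0 // coeff_twistA1 //.
  by have := refinedA j; lia.
have oA2 j : sec_ord (A2 X) (D X2) (g2 j) = (b j)%:Z - d%:Z.
  have [_ _ + _] := g2P j; rewrite /sec_ord (twists_div LilP) // coeff_twistA2 //; lia.
have oB2 j : sec_ord (B2 X) (D X2) (g2 j) = (b' (s j))%:Z.
  have [_ _ _] := g2P j; rewrite /sec_ord (twists_div LilP) // coeff_twistB2 //; lia.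
have oB3 j : sec_ord (B3 X) (D X3) (g3 j) = - (b' (s j))%:Z.
  have [_ _] := g3P j; rewrite /sec_ord (twists_div LilP) // coeff_twistB3 //.
  by have := refinedB (s j); lia.
have /choice[x xP] : forall j, exists x, x != 0 /\
    glueA (Lil (b j) 0%N) (cst (X X1) x * g1 j) (g2 j).
  move=> j; have [_ g10 _] := g1P j; have [_ g20 _ _] := g2P j.
  have [||x x0 xg] := @glueA_scale _ _ (Lil (b j) 0%N) _ _ g10 g20; last by exists x.
    move: (oA1 j); rewrite /sec_ord (twists_div LilP) ?addn0 ?db // coeff_twistA1 //; lia.
  move: (oA2 j); rewrite /sec_ord (twists_div LilP) ?addn0 ?db // coeff_twistA2 //; lia.
have /choice[y yP] : forall j, exists y, y != 0 /\
    glueB (Lil 0%N (b' (s j))) (g2 j) (cst (X X3) y * g3 j).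
  move=> j; have [_ g30 _] := g3P j; have [_ g20 _ _] := g2P j.
  have [||y y0 yg] := @glueB_scale _ _ (Lil 0%N (b' (s j))) _ _ g20 g30; last by exists y.
    move: (oB2 j); rewrite /sec_ord (twists_div LilP) ?db' // coeff_twistB2 //; lia.
  move: (oB3 j); rewrite /sec_ord (twists_div LilP) ?db' // coeff_twistB3 //; lia.
have scaleW q z f : W q f -> W q (cst (X q) z * f).
  move=> fW; rewrite -[_ * _]addr0; apply: (aspect_linear q).2 => //.
  exact: (aspect_linear q).1.
have W1 j : W X1 (cst (X X1) (x j) * g1 j) by apply: scaleW; case: (g1P j).
have W3 j : W X3 (cst (X X3) (y j) * g3 j) by apply: scaleW; case: (g3P j).
pose f j : rsec X := fun q => match q with
  X1 => cst (X X1) (x j) * g1 j | X2 => g2 j | X3 => cst (X X3) (y j) * g3 j end.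
exists f, s; split=> [j|].
  split=> //=.
  - exact: (aspect_RR (q := X1)).
  - by apply: (aspect_RR (q := X2)); case: (g2P j).
  - exact: (aspect_RR (q := X3)).
  - by rewrite /sec_ord val_atZ ?(xP j).1 //; apply: oA1.
  - by rewrite /sec_ord val_atZ ?(yP j).1 //; apply: oB3.
  - exact: (xP j).2.
  - exact: (yP j).2.
case.
- apply: (aspect_adapted (P := A1 X)) => [//|j|j j' /=].
    by rewrite mulf_neq0 ?fmorph_eq0 ?(xP j).1 //; case: (g1P j).
  rewrite !val_atZ ?(xP _).1 // => jj'; apply: (vanishing_orders_inj bP).
  by have := oA1 j; have := oA1 j'; rewrite /sec_ord; lia.
- apply: (aspect_adapted (P := A2 X)) => [j|j|j j' /= jj'].
  + by case: (g2P j).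
  + by case: (g2P j).
  apply: (vanishing_orders_inj bP).
  by have := oA2 j; have := oA2 j'; rewrite /sec_ord; lia.
apply: (aspect_adapted (P := B3 X)) => [//|j|j j' /=].
  by rewrite mulf_neq0 ?fmorph_eq0 ?(yP j).1 //; case: (g3P j).
rewrite !val_atZ ?(yP _).1 // => jj'; apply: sinj; apply: (vanishing_orders_inj b'P).
by have := oB3 j; have := oB3 j'; rewrite /sec_ord; lia.
Qed.

(** In the four lemmas that follow, the bound says that h vanishes at the node to
    order at least d + 1 as a section of the sheaf of multidegree d on its component,
    while all orders in a refined sequence are at most d. *)
Lemma aspect_order_A1 h : W X1 h -> ord_ge (A1 X) (d%:Z + 1 - coeff (A1 X) (D X1)) h -> h = 0.
Proof.
move=> hW hd; apply: (vanishing_orders_bound (d := d) aP _ hW).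
  by move=> j; have := refinedA (rev_ord j); rewrite rev_ordK; lia.
by apply: ord_ge_trans hd; rewrite (twists_div LilP) ?addn0 // coeff_twistA1 //; lia.
Qed.

Lemma aspect_order_A2 h : W X2 h -> ord_ge (A2 X) (1 - coeff (A2 X) (D X2)) h -> h = 0.
Proof.
move=> hW hd; apply: (vanishing_orders_bound (d := d) bP _ hW).
  by move=> j; have := refinedA j; lia.
by apply: ord_ge_trans hd; rewrite (twists_div LilP) // coeff_twistA2 //; lia.
Qed.

Lemma aspect_order_B2 h : W X2 h -> ord_ge (B2 X) (d%:Z + 1 - coeff (B2 X) (D X2)) h -> h = 0.
Proof.
move=> hW hd; apply: (vanishing_orders_bound (d := d) b'P _ hW).
  by move=> j; have := refinedB j; lia.
by apply: ord_ge_trans hd; rewrite (twists_div LilP) // coeff_twistB2 //; lia.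
Qed.

Lemma aspect_order_B3 h : W X3 h -> ord_ge (B3 X) (1 - coeff (B3 X) (D X3)) h -> h = 0.
Proof.
move=> hW hd; apply: (vanishing_orders_bound (d := d) cP _ hW).
  by move=> j; have := refinedB (rev_ord j); rewrite rev_ordK; lia.
by apply: ord_ge_trans hd; rewrite (twists_div LilP) // coeff_twistB3 //; lia.
Qed.

(** At the nodes of X_q, equality propagates from X_q to its neighbours, and from X_2
    to the remaining component: two sections glued to the same one differ by a
    section vanishing at the node, and at the extreme multidegree of X_q this is one
    order more than the aspect of the neighbour allows. *)
Lemma aspect_determines q s t : H0 (E q) s -> H0 (E q) t ->
  (forall p, W p (s p)) -> (forall p, W p (t p)) -> s q = t q -> s = t.
Proof.
move=> [_ [sA sB]] [_ [tA tB]] sW tW st.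
have WB p : W p (s p - t p) by apply: linear_setB; first exact: aspect_linear.
suff st' p : s p = t p by apply: functional_extensionality_dep.
have A12 : q = X1 -> s X2 = t X2.
  move=> qE; rewrite qE in st sA tA; rewrite st in sA.
  apply/eqP; rewrite -subr_eq0; apply/eqP/aspect_order_A2 => //.
  apply: ord_ge_trans (glueA_det2 sA tA).
  by rewrite (twists_div LilP) ?addn0 // coeff_twistA2 //; lia.
have A21 : q = X2 \/ q = X3 -> s X2 = t X2 -> s X1 = t X1.
  move=> qE st2; apply/eqP; rewrite -subr_eq0; apply/eqP/aspect_order_A1 => //.
  rewrite st2 in sA; apply: ord_ge_trans (glueA_det1 sA tA).
  by case: qE => ->; rewrite (twists_div LilP) // coeff_twistA1 //; lia.
have B23 : q = X1 \/ q = X2 -> s X2 = t X2 -> s X3 = t X3.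
  move=> qE st2; apply/eqP; rewrite -subr_eq0; apply/eqP/aspect_order_B3 => //.
  rewrite st2 in sB; apply: ord_ge_trans (glueB_det3 sB tB).
  by case: qE => ->; rewrite (twists_div LilP) ?addn0 // coeff_twistB3 //; lia.
have B32 : q = X3 -> s X2 = t X2.
  move=> qE; rewrite qE in st sB tB; rewrite st in sB.
  apply/eqP; rewrite -subr_eq0; apply/eqP/aspect_order_B2 => //.
  apply: ord_ge_trans (glueB_det2 sB tB).
  by rewrite (twists_div LilP) // coeff_twistB2 //; lia.
case: q {sA sB tA tB} st A12 A21 B23 B32 => st A12 A21 B23 B32; case: p => //; by auto.
Qed.

(** The extension is the sum of the truncated chains.  A member of V_(X_q) and a
    combination of truncated chains with the same component on X_q coincide, and
    all chains are kept on X_q at its extreme multidegree, so both spaces have the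
    same components there, namely the aspect. *)
Lemma exact_extension_exists : exists V : nat -> nat -> set (rsec X),
  limit_linear_series d r Lil V /\ exact_lls d V /\
  V d 0%N = Vq X1 /\ V 0%N 0%N = Vq X2 /\ V 0%N d = Vq X3.
Proof.
have [f [s [fP fW]]] := chains_exist.
pose b2 j := b' (s j).
have indep q : independent (fun j => f j q) by case: (fW q).
have VH0 i l : (i + l <= d)%N -> truncated_span f b b2 i l `<=` H0 (Lil i l).
  move=> il _ [x _ <-]; apply: H0_lincomb => j; exact: (H0_truncate LilP).
have Vex : exact_lls d (truncated_span f b b2) by apply: truncated_span_exact.
have VW i l t q : truncated_span f b b2 i l t -> W q (t q).
  case=> x _ <-; rewrite lincomb_truncate (fW q).2.
  by eexists.
have VE q i l : (i + l <= d)%N -> Lil i l = E q ->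
    (forall j, supp (b j) (b2 j) i l q) -> truncated_span f b b2 i l = Vq q.
  move=> il LE sq.
  have det t u : truncated_span f b b2 i l t -> Vq q u -> t q = u q -> t = u.
    move=> tV uV; apply: (@aspect_determines q).
    - by rewrite -LE; apply: VH0 il _ tV.
    - exact: Vq_H0.
    - by move=> p; apply: VW tV.
    - by move=> p; apply: aspect_comp uV.
  apply/seteqP; split=> [t tV|u uV].
    have [u uV ut] := VW _ _ _ q tV.
    by rewrite (det _ _ tV uV (esym ut)).
  have := aspect_comp q uV; rewrite (fW q).2 => -[x _ xu].
  have tV : truncated_span f b b2 i l (lincomb x (truncate f b b2 i l)) by exists x.
  rewrite -(det _ _ tV uV) // lincomb_truncate -xu.
  by congr comb; apply: funext => j; rewrite sq.
exists (truncated_span f b b2); split; first split.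
- exact: VH0.
- by move=> i l _; apply: truncated_span_dim.
- by move=> q i l i' l' /Vex[-> _] t [].
- by move=> q i l i' l' /Vex[_ ->] t [].
split=> //; split; [|split].
- by apply: (VE X1); rewrite ?addn0 // => j; have [? ? ] := fP j; rewrite /supp /b2 /=; lia.
- by apply: (VE X2) => // j; have [? ? ] := fP j; rewrite /supp /b2 /=; lia.
- by apply: (VE X3) => // j; have [? ? ] := fP j; rewrite /supp /b2 /=; lia.
Qed.

End Extension.

Theorem mainTheorem2 (k : closedFieldType) (X : chain k) (d r : nat)
    (L : line_bundle X) (Lil : nat -> nat -> line_bundle X)
    (V1 V2 V3 : set (rsec X)) (a b b' c : 'I_r.+1 -> nat)
    (degL1 : deg (lb_div L X1) = d%:Z)
    (degL2 : deg (lb_div L X2) = 0)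
    (degL3 : deg (lb_div L X3) = 0)
    (LilP : twists d L Lil)
    (V1H0 : V1 `<=` H0 (Lil d 0%N))
    (V2H0 : V2 `<=` H0 (Lil 0%N 0%N))
    (V3H0 : V3 `<=` H0 (Lil 0%N d))
    (V1dim : subspace_of_dim r.+1 V1)
    (V2dim : subspace_of_dim r.+1 V2)
    (V3dim : subspace_of_dim r.+1 V3)
    (V_linked : linked d V1 V2 V3)
    (V1inj : {in V1 &, injective (fun s => s X1)})
    (V2inj : {in V2 &, injective (fun s => s X2)})
    (V3inj : {in V3 &, injective (fun s => s X3)})
    (aP : vanishing_orders (A1 X) (lb_div (Lil d 0%N) X1) (restriction X1 V1) a)
    (bP : vanishing_orders (A2 X) (lb_div (Lil 0%N 0%N) X2) (restriction X2 V2) b)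
    (b'P : vanishing_orders (B2 X) (lb_div (Lil 0%N 0%N) X2) (restriction X2 V2) b')
    (cP : vanishing_orders (B3 X) (lb_div (Lil 0%N d) X3) (restriction X3 V3) c)
    (refinedA : forall j : 'I_r.+1, (a (rev_ord j) + b j = d)%N)
    (refinedB : forall j : 'I_r.+1, (b' j + c (rev_ord j) = d)%N) :
  exists V : nat -> nat -> set (rsec X),
    limit_linear_series d r Lil V /\ exact_lls d V /\
    V d 0%N = V1 /\ V 0%N 0%N = V2 /\ V 0%N d = V3.
Proof.
have [] := @exact_extension_exists k X d r L Lil
  (fun q => match q with X1 => V1 | X2 => V2 | X3 => V3 end) a b b' c LilP => //.
- by case.
- by case.
by move=> V; exists V.
Qed.
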